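(* Let $\gamma=(B,m,\sigma)$ be a fully mutated mutation sequence. Then $$\lim_{y\to0}K_\gamma(y)^{\mathsf T}=C(T),\qquad \lim_{y\to0}\bigl(A_+Z_-(y)+A_-Z_+(y)\bigr)=A_{\boldsymbol\varepsilon_{\mathrm{trop}}},$$ where ${}^{\mathsf T}$ denotes transpose. Thus $$\det(I_n-C(T))=\det A_{\boldsymbol\varepsilon_{\mathrm{trop}}}.$$
   Context: Fix a positive integer $n$. Write $[x]_+=\max(0,x)$. An $n\times n$ integer matrix $B$ is skew-symmetrizable if there are positive integers $d_1,\dots,d_n$ with $d_iB_{ij}=-d_jB_{ji}$. Let $\mathcal F_{\mathrm{sf}}$ be the set of rational functions $f/g$ in $y_1,\dots,y_n$ with $f,g\in\mathbb Q[y_1,\dots,y_n]$ nonzero polynomials with non-negative coefficients. A Y-seed is a pair $(B,Y)$ with $B$ an $n\times n$ skew-symmetrizable integer matrix and $Y=(Y_1,\dots,Y_n)\in\mathcal F_{\mathrm{sf}}^n$. For $k\in\{1,\dots,n\}$ the Y-seed mutation is $\mu_k(B,Y)=(\widetilde B,\widetilde Y)$ where: $\widetilde B_{ij}=-B_{ij}$ if $i=k$ or $j=k$; otherwise $\widetilde B_{ij}=B_{ij}+B_{ik}B_{kj}$ if $B_{ik}>0$ and $B_{kj}>0$, $\widetilde B_{ij}=B_{ij}-B_{ik}B_{kj}$ if $B_{ik}<0$ and $B_{kj}<0$, and $\widetilde B_{ij}=B_{ij}$ in the remaining cases; and $\widetilde Y_k=Y_k^{-1}$, while for $i\neq k$,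 $\widetilde Y_i=Y_i(Y_k^{-1}+1)^{-B_{ki}}$ if $B_{ki}\ge 0$ and $\widetilde Y_i=Y_i(Y_k+1)^{-B_{ki}}$ if $B_{ki}\le 0$. A permutation $\sigma$ of $\{1,\dots,n\}$ acts by $\sigma(B,Y)=(\sigma(B),\sigma(Y))$, $\sigma(B)_{ij}=B_{\sigma^{-1}(i)\sigma^{-1}(j)}$, $\sigma(Y)_i=Y_{\sigma^{-1}(i)}$. A mutation sequence (of length $T\ge 1$) is a triple $\gamma=(B,m,\sigma)$ with $B$ an $n\times n$ skew-symmetrizable integer matrix, $m=(m_1,\dots,m_T)$ a sequence in $\{1,\dots,n\}$ and $\sigma=(\sigma_1,\dots,\sigma_T)$ a sequence of permutations of $\{1,\dots,n\}$. Put $(B(0),Y(0))=(B,(y_1,\dots,y_n))$ and $(B(t),Y(t))=\sigma_t(\mu_{m_t}(B(t-1),Y(t-1)))$ for $t=1,\dots,T$. The cluster transformation of $\gamma$ is $\mu_\gamma(y)=Y(T)$, with components $\mu_1(y),\dots,\mu_n(y)$. Mutation network. Let $\overline{\mathcal E}=\{(i,t)\mid 1\le i\le n,\ 0\le t\le T\}$ and let $\sim$ be the equivalence relation on $\overline{\mathcal E}$ generated by $(i,t-1)\sim(\sigma_t(i),t)$ for $1\le t\le T$ and $i\ne m_t$, and $(i,T)\sim(i,0)$ for all $i$. Put $\mathcal E=\overline{\mathcal E}/\sim$. The mutation network $\mathcal N_\gamma$ is the graph with black vertices labeled by $\mathcal E$, square vertices labeled by $1,\dots,T$, and for each $t$ the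 following edges (all kept with multiplicity, without cancelling opposite arrows): one broken edge between $t$ and $[(m_t,t-1)]$ and one broken edge between $t$ and $[(\sigma_t(m_t),t)]$; and, for each $i$, $[B_{m_t,i}(t-1)]_+$ arrows from $t$ to $[(i,t-1)]$ and $[-B_{m_t,i}(t-1)]_+$ arrows from $[(i,t-1)]$ to $t$. For $e\in\mathcal E$ and $1\le t\le T$ let $n^0_{et}$ be the number of broken edges between $e$ and $t$, $n^+_{et}$ the number of arrows from $t$ to $e$, $n^-_{et}$ the number of arrows from $e$ to $t$; let $N_0,N_+,N_-$ be the corresponding $\mathcal E\times T$ matrices. The Neumann-Zagier matrices are $A_+=N_0-N_+$ and $A_-=N_0-N_-$. For $\boldsymbol\varepsilon=(\varepsilon_1,\dots,\varepsilon_T)\in\{+,-\}^T$, $A_{\boldsymbol\varepsilon}$ is the matrix whose $t$-th column is the $t$-th column of $A_{\varepsilon_t}$. $\gamma$ is fully mutated if for every $e\in\mathcal E$ there is $t\in\{1,\dots,T\}$ with $(m_t,t-1)\in e$. In that case $t\mapsto[(m_t,t-1)]$ is a bijection $\{1,\dots,T\}\to\mathcal E$, and $\mathcal E\times T$ matrices such as $A_\pm$, $A_{\boldsymbol\varepsilon}$ are regarded as $T\times T$ matrices through it. Let $J_\gamma(y)=(\partial\mu_i/\partial y_j)_{1\le i,j\le n}$ and $K_\gamma(y)=\mathrm{diag}(\mu_1(y),\dots,\mu_n(y))^{-1}J_\gamma(y)\,\mathrm{diag}(y_1,\dots,y_n)$. For $1\le t\le T$ let $z_{t,+}=\frac{Y_{m_t}(t-1)}{Y_{m_t}(t-1)+1}$,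 $z_{t,-}=\frac{1}{Y_{m_t}(t-1)+1}$ (where $Y(t)=(Y_1(t),\dots,Y_n(t))\in\mathcal F_{\mathrm{sf}}^n$ is the second component of the Y-seed $(B(t),Y(t))$ obtained from $(B(0),Y(0))=(B,(y_1,\dots,y_n))$ by successively applying $\sigma_s\circ\mu_{m_s}$ for $s=1,\dots,t$, with the usual addition in $\mathcal F_{\mathrm{sf}}$), and $Z_\pm(y)=\mathrm{diag}(z_{1,\pm},\dots,z_{T,\pm})$. $C$-matrices. Let $\mathcal F_{\mathrm{trop}}$ be the set of Laurent monomials in $y_1,\dots,y_n$ with the usual multiplication and the addition $\prod_i y_i^{a_i}\oplus\prod_i y_i^{b_i}=\prod_i y_i^{\min(a_i,b_i)}$. Mutations of Y-seeds $(B,Y)$ with $Y\in\mathcal F_{\mathrm{trop}}^n$ are defined by the same formulas with $+$ in the formulas for $\widetilde Y$ replaced by $\oplus$. Starting from $(B,(y_1,\dots,y_n))$ and applying $\sigma_t\circ\mu_{m_t}$ for $t=1,\dots,T$ successively in the tropical semifield gives $Y^{\mathrm{trop}}(t)\in\mathcal F_{\mathrm{trop}}^n$; define integers $c_{ij}(t)$ by $Y^{\mathrm{trop}}_j(t)=y_1^{c_{1j}(t)}\cdots y_n^{c_{nj}(t)}$, and let $C(t)=(c_{ij}(t))_{1\le i,j\le n}$ with columns $\mathbf c_j(t)$. By the known sign-coherence theorem, each $\mathbf c_j(t)$ is non-zero with entries either all non-negative or all non-positive. Let $\boldsymbol\varepsilon_{\mathrm{trop}}=(\varepsilon_1,\dots,\varepsilon_T)$,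 where $\varepsilon_t\in\{+,-\}$ is the sign of $\mathbf c_{m_t}(t-1)$. The limit $y\to0$ means: substitute $y_i=\epsilon$ for every $i$, with $\epsilon$ a positive real number, and let $\epsilon\to0$. *)

(* Defs.v *)
(* MathComp, MathComp-Analysis and multinomials.  The notations of mpoly clash
   with those of MathComp-Analysis and are not imported: a polynomial over
   rat in n variables is an element of [mpoly n rat], its coefficient at a
   monomial m is [mcoeff m p], its i-th partial derivative is [mderiv i p] and
   [mmap f v p] evaluates p at v after applying f to the coefficients. *)
From mathcomp Require Import all_boot all_order all_fingroup all_algebra.
From mathcomp Require Import generic_quotient fraction.
From mathcomp Require Import -(notations) mpoly.
From mathcomp Require Import ring.
From mathcomp Require Import all_classical all_reals all_analysis.

Set Implicit Arguments.
Unset Strict Implicit.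
Unset Printing Implicit Defensive.

Import Order.TTheory GRing.Theory Num.Theory numFieldNormedType.Exports.

Local Open Scope ring_scope.

Section RationalFunctions.
Variable n : nat.

Definition ratfun := {fraction (mpoly n rat)}.

Definition tofun (p : mpoly n rat) : ratfun := @FracField.tofrac _ p.

Definition indet (i : 'I_n) : ratfun := tofun (mpolyX rat (mnm1 i)).

Definition fractions_of (x : ratfun) : set (mpoly n rat * mpoly n rat) :=
  [set p | p.2 != 0 /\ x = tofun p.1 / tofun p.2]%classic.

(* The quotient rule, applied to some presentation x = f / g; [ratfun_derivE]
   shows that every presentation gives the same result. *)
Definition ratfun_deriv (j : 'I_n) (x : ratfun) : ratfun :=
  let p := xget (0, 1) (fractions_of x) in
  tofun (mderiv j p.1 * p.2 - p.1 * mderiv j p.2) / tofun p.2 ^+ 2.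

(* The value at v of a rational function that is regular at v, computed from a
   presentation f / g with g(v) <> 0; the value is independent of that choice
   by [ratfun_evalE].  It is 0 where no such presentation exists. *)
Definition ratfun_eval (R : realType) (x : ratfun) (v : 'I_n -> R) : R :=
  let ev := mmap (@ratr R) v in
  let p := xget (0, 1) (fractions_of x `&` [set p | ev p.2 != 0])%classic in
  ev p.1 / ev p.2.

Lemma tofunM : {morph tofun : p q / p * q}.
Proof. exact: tofracM. Qed.

Lemma tofunD : {morph tofun : p q / p + q}.
Proof. exact: tofracD. Qed.

Lemma tofunB : {morph tofun : p q / p - q}.
Proof. exact: tofracB. Qed.

Lemma tofun1 : tofun 1 = 1.
Proof. exact: tofrac1. Qed.

Lemma tofun_eq0 p : (tofun p == 0) = (p == 0).
Proof. exact: tofrac_eq0. Qed.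

Lemma tofun_inj : injective tofun.
Proof. by move=> p q /eqP; rewrite /tofun tofrac_eq => /eqP. Qed.

Lemma eq_tofun_div (f g f' g' : mpoly n rat) : g != 0 -> g' != 0 ->
  tofun f / tofun g = tofun f' / tofun g' -> f * g' = f' * g.
Proof.
move=> g0 g'0 /eqP; rewrite eqr_div ?tofun_eq0// -!tofunM => /eqP.
exact: tofun_inj.
Qed.

Lemma fractions_of_nonempty x : exists p, fractions_of x p.
Proof.
elim/quotW: x => r; have d0 := denom_ratioP r.
exists ((frac r).1, (frac r).2); split=> //=.
apply: (canRL (mulfK _)); first by rewrite tofun_eq0.
rewrite -{1}(Ratio_numden r) /tofun; unlock FracField.tofrac.
rewrite -[LHS]FracField.pi_mul; apply/eqP; rewrite -[_ == _]/(_ == _ %[mod _])%qT.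
rewrite FracField.equivf_def /FracField.equivf /FracField.mulf /=.
by rewrite !numden_Ratio ?mulf_neq0 ?oner_neq0// ?mulr1// mulrC.
Qed.

Lemma ratfun_derivE (j : 'I_n) (f g : mpoly n rat) : g != 0 ->
  ratfun_deriv j (tofun f / tofun g) =
  tofun (mderiv j f * g - f * mderiv j g) / tofun g ^+ 2.
Proof.
move=> g0; rewrite /ratfun_deriv.
case: xgetP => [[f' g'] _ [/= g'0 /esym e]|]; last first.
  by have [p hp] := fractions_of_nonempty (tofun f / tofun g) => /(_ p).
have {}e := eq_tofun_div g'0 g0 e.
have := congr1 (mderiv j) e; rewrite !mderivM => de.
apply/eqP; rewrite eqr_div ?expf_neq0 ?tofun_eq0// !expr2 -!tofunM.
apply/eqP; congr tofun.
move: (mderiv j f) (mderiv j g) (mderiv j f') (mderiv j g') de => a b a' b' de.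
have -> : (a' * g' - f' * b') * (g * g) = g' * g * (a' * g) - b' * g * (f' * g).
  by ring.
have -> : a' * g = a * g' + f * b' - f' * b by rewrite -de addrK.
have -> : g' * g * (a * g' + f * b' - f' * b) =
  g' * g * (a * g' + f * b') - g' * b * (f' * g) by ring.
by rewrite e; ring.
Qed.

Lemma ratfun_evalE (R : realType) (f g : mpoly n rat) (v : 'I_n -> R) :
  mmap (@ratr R) v g != 0 ->
  ratfun_eval (tofun f / tofun g) v =
  mmap (@ratr R) v f / mmap (@ratr R) v g.
Proof.
move=> gv; have g0 : g != 0 by apply: contraNneq gv => ->; rewrite raddf0.
rewrite /ratfun_eval.
case: xgetP => [[f' g'] _ [[/= g'0 /esym e] g'v]|/(_ (f, g))]; last by case.
apply/eqP; rewrite eqr_div// -!rmorphM /=; apply/eqP; congr mmap.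
exact: eq_tofun_div.
Qed.

Definition nneg_coeffs (p : mpoly n rat) : Prop := forall m, 0 <= mcoeff m p.

Definition subtraction_free (x : ratfun) : Prop :=
  exists f g : mpoly n rat,
    [/\ f != 0, g != 0, nneg_coeffs f, nneg_coeffs g & x = tofun f / tofun g].

Lemma nneg_coeffsM p q :
  nneg_coeffs p -> nneg_coeffs q -> nneg_coeffs (p * q).
Proof.
by move=> hp hq m; rewrite mcoeffM; apply: sumr_ge0 => k _; apply: mulr_ge0.
Qed.

Lemma nneg_coeffsD p q :
  nneg_coeffs p -> nneg_coeffs q -> nneg_coeffs (p + q).
Proof. by move=> hp hq m; rewrite mcoeffD addr_ge0. Qed.

Lemma nneg_coeffsD_neq0 p q :
  nneg_coeffs p -> nneg_coeffs q -> p != 0 -> p + q != 0.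
Proof.
move=> hp hq; apply: contra_neq => pq0; apply/mpolyP => m; rewrite mcoeff0.
have /eqP := congr1 (mcoeff m) pq0.
by rewrite mcoeffD mcoeff0 paddr_eq0// => /andP[/eqP].
Qed.

Lemma nneg_coeffsX m : nneg_coeffs (mpolyX rat m).
Proof. by move=> k; rewrite mcoeffX ler0n. Qed.

Lemma nneg_coeffs1 : nneg_coeffs 1.
Proof. by move=> k; rewrite mcoeff1 ler0n. Qed.

Lemma subtraction_free1 : subtraction_free 1.
Proof.
exists 1, 1; split; rewrite ?oner_neq0//; try exact: nneg_coeffs1.
by rewrite tofun1 divr1.
Qed.

Lemma subtraction_free_indet i : subtraction_free (indet i).
Proof.
exists (mpolyX rat (mnm1 i)), 1; split; rewrite ?oner_neq0//.
- by rewrite -msupp_eq0 msuppX.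
- exact: nneg_coeffsX.
- exact: nneg_coeffs1.
- by rewrite tofun1 divr1.
Qed.

Lemma subtraction_freeM x y :
  subtraction_free x -> subtraction_free y -> subtraction_free (x * y).
Proof.
move=> [f [g [f0 g0 hf hg ->]]] [f' [g' [f'0 g'0 hf' hg' ->]]].
exists (f * f'), (g * g'); split; rewrite ?mulf_neq0//; try exact: nneg_coeffsM.
by rewrite mulf_div !tofunM.
Qed.

Lemma subtraction_freeV x : subtraction_free x -> subtraction_free x^-1.
Proof.
by move=> [f [g [f0 g0 hf hg ->]]]; exists g, f; split=> //; rewrite invf_div.
Qed.

Lemma subtraction_freeD x y :
  subtraction_free x -> subtraction_free y -> subtraction_free (x + y).
Proof.
move=> [f [g [f0 g0 hf hg ->]]] [f' [g' [f'0 g'0 hf' hg' ->]]].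
exists (f * g' + f' * g), (g * g'); split; rewrite ?mulf_neq0//.
- by apply: nneg_coeffsD_neq0; rewrite ?mulf_neq0//; apply: nneg_coeffsM.
- by apply: nneg_coeffsD; apply: nneg_coeffsM.
- exact: nneg_coeffsM.
- by rewrite addf_div ?tofun_eq0// tofunD !tofunM.
Qed.

End RationalFunctions.

(* The operations of a semifield; the axioms play no role in the definition of
   mutation. *)
Record semifield := Semifield {
  sf_car :> Type;
  sf_one : sf_car;
  sf_mul : sf_car -> sf_car -> sf_car;
  sf_inv : sf_car -> sf_car;
  sf_add : sf_car -> sf_car -> sf_car }.

Definition sf_pow (S : semifield) (x : S) (a : int) : S :=
  match a with
  | Posz k => iter k (sf_mul x) (sf_one S)
  | Negz k => sf_inv (iter k.+1 (sf_mul x) (sf_one S))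
  end.

Section Semifields.
Variable n : nat.

Definition Fsf_car := {x : ratfun n | subtraction_free x}.

Definition Fsf : semifield := @Semifield Fsf_car
  (exist _ 1 (subtraction_free1 n))
  (fun x y => exist _ (sval x * sval y) (subtraction_freeM (svalP x) (svalP y)))
  (fun x => exist _ (sval x)^-1 (subtraction_freeV (svalP x)))
  (fun x y => exist _ (sval x + sval y) (subtraction_freeD (svalP x) (svalP y))).

Definition Fsf_indet (i : 'I_n) : Fsf := exist _ (indet i) (subtraction_free_indet i).

(* The Laurent monomial y_1 ^ a_1 ... y_n ^ a_n is its exponent vector a. *)
Definition Ftrop : semifield := @Semifield 'cV[int]_n
  0 (fun a b => a + b) (fun a => - a)
  (fun a b => \col_i Num.min (a i 0) (b i 0)).

Definition Ftrop_indet (i : 'I_n) : Ftrop := delta_mx i 0.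

End Semifields.

Definition skew_symmetrizable n (B : 'M[int]_n) : Prop :=
  exists d : 'I_n -> int,
    (forall i, 0 < d i) /\ (forall i j, d i * B i j = - (d j * B j i)).

Definition mx_mutation n (k : 'I_n) (B : 'M[int]_n) : 'M[int]_n :=
  \matrix_(i, j)
    if (i == k) || (j == k) then - B i j
    else if (0 < B i k) && (0 < B k j) then B i j + B i k * B k j
    else if (B i k < 0) && (B k j < 0) then B i j - B i k * B k j
    else B i j.

Definition mx_relabel n (s : {perm 'I_n}) (B : 'M[int]_n) : 'M[int]_n :=
  \matrix_(i, j) B (s^-1%g i) (s^-1%g j).

Lemma mx_mutation_skew n (k : 'I_n) (B : 'M[int]_n) :
  skew_symmetrizable B -> skew_symmetrizable (mx_mutation k B).
Proof.
move=> [d [d0 dB]]; exists d; split=> // i j; rewrite !mxE orbC.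
case: ifP => _; first by rewrite !mulrN dB.
have pos a b : (0 < B a b) = (B b a < 0).
  by rewrite -(pmulr_rgt0 _ (d0 a)) dB oppr_gt0 pmulr_rlt0.
have neg a b : (B a b < 0) = (0 < B b a) by rewrite pos.
rewrite !pos !neg [X in _ = - (_ * (if X then _ else _))]andbC.
rewrite [X in _ = - (_ * (if _ then _ else if X then _ else _))]andbC.
have key : d i * (B i k * B k j) = d j * (B j k * B k i).
  rewrite mulrA dB mulNr -mulrA (mulrCA (d k)).
  by rewrite dB mulrN opprK mulrCA; congr (_ * _); rewrite mulrC.
have [/andP[p q]|_] := ifP.
  have -> : (0 < B k i) && (0 < B j k) = false.
    by move: p; rewrite -neg => /ltW; rewrite leNgt => /negbTE->.
  by rewrite mulrDr mulrBr key dB opprB addrC.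
by case: ifP => _; rewrite ?mulrBr ?mulrDr ?key dB// opprD.
Qed.

Lemma mx_relabel_skew n (s : {perm 'I_n}) (B : 'M[int]_n) :
  skew_symmetrizable B -> skew_symmetrizable (mx_relabel s B).
Proof.
move=> [d [d0 dB]]; exists (fun i => d (s^-1%g i)).
by split=> // i j; rewrite !mxE dB.
Qed.

Record yseed (S : semifield) (n : nat) := YSeed {
  yseed_B : 'M[int]_n;
  yseed_skew : skew_symmetrizable yseed_B;
  yseed_Y : 'I_n -> S }.

Definition Y_mutation (S : semifield) n (k : 'I_n) (B : 'M[int]_n)
    (Y : 'I_n -> S) (i : 'I_n) : S :=
  if i == k then sf_inv (Y k)
  else if 0 <= B k i
  then sf_mul (Y i) (sf_pow (sf_add (sf_inv (Y k)) (sf_one S)) (- B k i))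
  else sf_mul (Y i) (sf_pow (sf_add (Y k) (sf_one S)) (- B k i)).

Definition yseed_mutation (S : semifield) n (k : 'I_n) (s : yseed S n) :
    yseed S n :=
  YSeed (mx_mutation_skew k (yseed_skew s))
        (Y_mutation k (yseed_B s) (yseed_Y s)).

Definition yseed_relabel (S : semifield) n (p : {perm 'I_n}) (s : yseed S n) :
    yseed S n :=
  YSeed (mx_relabel_skew p (yseed_skew s)) (fun i => yseed_Y s (p^-1%g i)).

(* Steps are numbered from 0: the entries m_t and sigma_t with 1 <= t <= T are
   those of index t - 1 in 'I_T.  Seeds keep their numbering 0, ..., T. *)
Record mutation_sequence (n T : nat) := MutationSequence {
  mseq_B : 'M[int]_n;
  mseq_skew : skew_symmetrizable mseq_B;
  mseq_m : T.-tuple 'I_n;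
  mseq_sigma : T.-tuple {perm 'I_n} }.

Definition seed_at (S : semifield) n T (y : 'I_n -> S)
    (gamma : mutation_sequence n T) (t : nat) : yseed S n :=
  foldl (fun s (a : 'I_n * {perm 'I_n}) =>
           yseed_relabel a.2 (yseed_mutation a.1 s))
    (YSeed (mseq_skew gamma) y)
    (take t (zip (mseq_m gamma) (mseq_sigma gamma))).

Section MutationSequence.
Variables n T : nat.
Variable gamma : mutation_sequence n T.

Definition mut (t : 'I_T) : 'I_n := tnth (mseq_m gamma) t.

Definition relabel (t : 'I_T) : {perm 'I_n} := tnth (mseq_sigma gamma) t.

Definition B_at (t : nat) : 'M[int]_n :=
  yseed_B (seed_at (@Fsf_indet n) gamma t).

Definition Y_at (t : nat) (i : 'I_n) : ratfun n :=
  sval (yseed_Y (seed_at (@Fsf_indet n) gamma t) i).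

Definition Ytrop_at (t : nat) (i : 'I_n) : 'cV[int]_n :=
  yseed_Y (seed_at (@Ftrop_indet n) gamma t) i.

Lemma seed_at0 (S : semifield) (y : 'I_n -> S) :
  seed_at y gamma 0 = YSeed (mseq_skew gamma) y.
Proof. by rewrite /seed_at take0. Qed.

Lemma seed_atS (S : semifield) (y : 'I_n -> S) (t : 'I_T) :
  seed_at y gamma t.+1 =
  yseed_relabel (relabel t) (yseed_mutation (mut t) (seed_at y gamma t)).
Proof.
have sz : size (zip (mseq_m gamma) (mseq_sigma gamma)) = T.
  by rewrite size_zip !size_tuple minnn.
rewrite /seed_at (take_nth (mut t, relabel t)) ?sz// -cats1 foldl_cat /=.
by rewrite nth_zip ?size_tuple//= -!tnth_nth.
Qed.

Definition cluster_transformation (i : 'I_n) : ratfun n := Y_at T i.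

Definition before (t : 'I_T) : 'I_T.+1 := widen_ord (leqnSn T) t.

Definition after (t : 'I_T) : 'I_T.+1 := lift ord0 t.

Definition glue (p q : 'I_n * 'I_T.+1) : bool :=
  [exists t : 'I_T, exists i : 'I_n,
     [&& i != mut t, p == (i, before t) & q == (relabel t i, after t)]]
  || [exists i : 'I_n, (p == (i, ord_max)) && (q == (i, ord0))].

(* The reflexive, symmetric and transitive closure of [glue]. *)
Definition glue_equiv : rel ('I_n * 'I_T.+1) :=
  connect (fun p q => glue p q || glue q p).

Definition edge_class (p : 'I_n * 'I_T.+1) : {set 'I_n * 'I_T.+1} :=
  [set q | glue_equiv p q]%SET.

Definition edge_classes : {set {set 'I_n * 'I_T.+1}} :=
  [set edge_class p | p : 'I_n * 'I_T.+1]%SET.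

Definition fully_mutated : Prop :=
  forall e, e \in edge_classes -> exists t : 'I_T, (mut t, before t) \in e.

Definition broken_edges (e : {set 'I_n * 'I_T.+1}) (t : 'I_T) : int :=
  (edge_class (mut t, before t) == e)%:R
  + (edge_class (relabel t (mut t), after t) == e)%:R.

Definition arrows_from_square (e : {set 'I_n * 'I_T.+1}) (t : 'I_T) : int :=
  \sum_(i < n | edge_class (i, before t) == e) Num.max 0 (B_at t (mut t) i).

Definition arrows_to_square (e : {set 'I_n * 'I_T.+1}) (t : 'I_T) : int :=
  \sum_(i < n | edge_class (i, before t) == e) Num.max 0 (- B_at t (mut t) i).

(* Rows are labeled by 'I_T through s |-> [edge_class (mut s, before s)], which
   is a bijection onto [edge_classes] when the sequence is fully mutated. *)
Definition NZ_mx (N : {set 'I_n * 'I_T.+1} -> 'I_T -> int) : 'M[int]_T :=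
  \matrix_(s, t) N (edge_class (mut s, before s)) t.

Definition N_zero : 'M[int]_T := NZ_mx broken_edges.
Definition N_plus : 'M[int]_T := NZ_mx arrows_from_square.
Definition N_minus : 'M[int]_T := NZ_mx arrows_to_square.

Definition A_plus : 'M[int]_T := N_zero - N_plus.
Definition A_minus : 'M[int]_T := N_zero - N_minus.

(* In sign sequences, true stands for + and false for -. *)
Definition A_sign (eps : T.-tuple bool) : 'M[int]_T :=
  \matrix_(s, t) if tnth eps t then A_plus s t else A_minus s t.

Definition jacobian_mx : 'M[ratfun n]_n :=
  \matrix_(i, j) ratfun_deriv j (cluster_transformation i).

Definition K_mx : 'M[ratfun n]_n :=
  invmx (diag_mx (\row_i cluster_transformation i)) *m jacobian_mx
  *m diag_mx (\row_j indet j).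

Definition z_plus (t : 'I_T) : ratfun n :=
  Y_at t (mut t) / (Y_at t (mut t) + 1).

Definition z_minus (t : 'I_T) : ratfun n := 1 / (Y_at t (mut t) + 1).

Definition Z_plus : 'M[ratfun n]_T := diag_mx (\row_t z_plus t).
Definition Z_minus : 'M[ratfun n]_T := diag_mx (\row_t z_minus t).

Definition AZ_mx : 'M[ratfun n]_T :=
  map_mx intr A_plus *m Z_minus + map_mx intr A_minus *m Z_plus.

Definition C_mx (t : nat) : 'M[int]_n := \matrix_(i, j) Ytrop_at t j i 0.

Definition has_sign (b : bool) (c : 'cV[int]_n) : Prop :=
  c != 0 /\ forall i, if b then 0 <= c i 0 else c i 0 <= 0.

(* [eps] is the tropical sign sequence.  It is given by a relation because its
   existence is the sign-coherence theorem; it is unique as signed vectors are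
   non-zero. *)
Definition is_tropical_sign (eps : T.-tuple bool) : Prop :=
  forall t : 'I_T, has_sign (tnth eps t) (col (mut t) (C_mx t)).

End MutationSequence.

(* The matrix of the values of M at the point (e, ..., e). *)
Definition eval_diagonal (R : realType) n p q (M : 'M[ratfun n]_(p, q)) (e : R) :
    'M[R]_(p, q) :=
  map_mx (fun x => ratfun_eval x (fun=> e)) M.

(* Main.v *)
Require Import Defs.
From mathcomp Require Import all_boot all_order all_fingroup all_algebra.
From mathcomp Require Import -(notations) mpoly.
From mathcomp Require Import ring.
From mathcomp Require Import all_classical all_reals all_analysis.

(* By sign-coherence, each Y_j(t) is its tropical value y^(c_j(t)) times a
   quotient of polynomials with constant term 1.  Hence y_i times the
   logarithmic derivative of Y_j(T) in y_i tends to c_ij(T), while z_(t,+) tends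
   to 0 or 1 according to the tropical sign; this gives both limits.

   The determinants are compared directly, without the matrices K and A Z.  For
   a fixed sign the tropical mutation is linear, so C(t) = C(t-1) E_t for an
   integer matrix E_t.  Consider the linear system v(t-1) = E_t v(t),
   v(T) = v(0) in the unknowns v_i(t), indexed by the pairs (i,t).  Solving all
   v(t) in terms of v(T) is a unitriangular elimination leaving I - C(T).
   Alternatively, all equations but the T ones of the rows (m_t,t-1) only
   identify two unknowns related by ~; since every class contains exactly one
   (m_t,t-1), eliminating the other unknowns along each class is again
   unitriangular, and leaves the transpose of A_eps. *)

Set Implicit Arguments.
Unset Strict Implicit.
Unset Printing Implicit Defensive.

Import Order.TTheory GRing.Theory Num.Theory numFieldNormedType.Exports.
Local Open Scope ring_scope.

(** * Determinants of matrices indexed by a finite type *)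

(** One block matrix with unit diagonal blocks is factored in two ways into block triangular
    ones. *)
Lemma det_1Dmulmx (R : comNzRingType) m n (A : 'M[R]_(m, n)) (B : 'M[R]_(n, m)) :
  \det (1%:M + A *m B) = \det (1%:M + B *m A).
Proof.
have lower : block_mx 1%:M (- A) B 1%:M =
    block_mx 1%:M 0 B 1%:M *m block_mx 1%:M (- A) 0 (1%:M + B *m A).
  rewrite mulmx_block !mul1mx !mul0mx !mulmx1 ?mulmx0 !addr0.
  by rewrite mulmxN addrC addrK.
have upper : block_mx 1%:M (- A) B 1%:M =
    block_mx 1%:M (- A) 0 1%:M *m block_mx (1%:M + A *m B) 0 B 1%:M.
  rewrite mulmx_block !mul1mx !mul0mx !mulmx1 ?mulmx0 ?add0r ?addr0.
  by rewrite mulNmx addrK.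
have := congr1 determinant lower; rewrite upper !det_mulmx.
by rewrite !det_ublock !det_lblock !det1 !mul1r mulr1.
Qed.

Lemma invmx_diag (F : fieldType) k (d : 'rV[F]_k) : (forall i, d 0 i != 0) ->
  invmx (diag_mx d) = diag_mx (\row_i (d 0 i)^-1).
Proof.
move=> d0; have dV : diag_mx d *m diag_mx (\row_i (d 0 i)^-1) = 1%:M.
  by rewrite mulmx_diag; apply/matrixP => i j; rewrite !mxE mulfV.
by have [dU _] := mulmx1_unit dV; rewrite -[LHS]mulmx1 -dV mulKmx.
Qed.

Section FinMatrix.
Variables (R : comNzRingType) (V : finType).
Implicit Types F G : V -> V -> R.

Definition finmx F : 'M[R]_#|V| := \matrix_(a, b) F (enum_val a) (enum_val b).

Lemma finmx_mul F G :
  finmx F *m finmx G = finmx (fun p q => \sum_r F p r * G r q).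
Proof.
apply/matrixP => a b; rewrite !mxE [RHS](reindex (@enum_val V predT)) /=.
  by apply: eq_bigr => c _; rewrite !mxE.
exact/onW_bij/enum_val_bij.
Qed.

(** A permutation contributing to the Leibniz expansion never raises the rank of an index. As the
    sum of the ranks is invariant under reindexing, every rank is kept, which forces the
    identity. *)
Lemma det_finmx_unitri F (rank : V -> nat) :
  (forall p, F p p = 1) ->
  (forall p q, p != q -> F p q != 0 -> (rank q < rank p)%N) ->
  \det (finmx F) = 1.
Proof.
move=> F1 Frank; rewrite /determinant (bigD1 1%g) //= odd_perm1 expr0 mul1r.
rewrite big1 => [|a _]; last by rewrite mxE perm1.
rewrite big1 ?addr0 // => s s1; apply/eqP; rewrite -[_ == 0]negbK; apply: contra s1.
move=> prod_neq0; apply/eqP/permP => a; rewrite perm1.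
have fac b : F (enum_val b) (enum_val (s b)) != 0.
  apply: contraNneq prod_neq0 => Fb0.
  by rewrite (bigD1 b) //= mxE Fb0 mul0r mulr0.
have le b : (rank (enum_val (s b)) <= rank (enum_val b))%N.
  have [-> //|sb] := eqVneq (s b) b.
  by apply/ltnW/Frank; rewrite ?fac // (inj_eq enum_val_inj) eq_sym.
have sum_eq : (\sum_(b < #|V|) rank (enum_val (s b)) ==
    \sum_(b < #|V|) rank (enum_val b))%N.
  by apply/eqP; rewrite [RHS](reindex_inj (@perm_inj _ s)).
have rank_eq : rank (enum_val (s a)) = rank (enum_val a).
  move: sum_eq; rewrite (leqif_sum (fun b _ => leqif_eq (le b))).
  by move=> /forallP/(_ a)/eqP.
apply/eqP; rewrite -[_ == _]negbK; apply/negP => sa.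
have := Frank (enum_val a) (enum_val (s a)).
by rewrite (inj_eq enum_val_inj) eq_sym sa fac rank_eq ltnn => /(_ isT isT).
Qed.

(** Only the [k] rows [g a] differ from those of the identity, so [finmx F = 1 + L H] with [L] of
    [k] columns, and [det_1Dmulmx] leaves a determinant of size [k]. *)
Lemma det_finmx_rows F k (g : 'I_k -> V) : injective g ->
  (forall p q, p \notin codom g -> F p q = (p == q)%:R) ->
  \det (finmx F) = \det (\matrix_(a, b) F (g a) (g b)).
Proof.
move=> g_inj Fid.
pose L : 'M[R]_(#|V|, k) := \matrix_(a, b) (enum_val a == g b)%:R.
pose H : 'M[R]_(k, #|V|) :=
  \matrix_(a, b) (F (g a) (enum_val b) - (g a == enum_val b)%:R).
have -> : finmx F = 1%:M + L *m H.
  apply/matrixP => a b; rewrite !mxE -(inj_eq enum_val_inj).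
  have [/codomP[c ac]|ac] := boolP (enum_val a \in codom g).
    rewrite (bigD1 c) //= big1 ?addr0 => [|d dc].
      by rewrite !mxE ac eqxx mul1r addrC subrK.
    by rewrite !mxE ac (inj_eq g_inj) eq_sym (negbTE dc) mul0r.
  rewrite Fid // big1 ?addr0 // => d _; rewrite !mxE.
  case: eqP => [ad|_]; last by rewrite mul0r.
  by rewrite ad codom_f in ac.
rewrite det_1Dmulmx; congr (\det _); apply/matrixP => a b; rewrite !mxE.
rewrite (bigD1 (enum_rank (g b))) //= big1 => [|c cb]; last first.
  rewrite !mxE; case: (enum_val c =P g b) => [cb'|_]; last by rewrite mulr0.
  by rewrite -cb' enum_valK eqxx in cb.
by rewrite !mxE enum_rankK eqxx mulr1 addr0 (inj_eq g_inj) addrC subrK.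
Qed.

(** Right multiplication by the unitriangular [S] keeps the determinant and turns the rows outside
    the image of [g] into rows of the identity. *)
Lemma det_finmx_eliminate F S (rank : V -> nat) k (g : 'I_k -> V) :
  injective g ->
  (forall p, S p p = 1) ->
  (forall p q, p != q -> S p q != 0 -> (rank q < rank p)%N) ->
  (forall p q, p \notin codom g -> \sum_r F p r * S r q = (p == q)%:R) ->
  \det (finmx F) = \det (\matrix_(a, b) \sum_r F (g a) r * S r (g b)).
Proof.
move=> g_inj S1 Srank FS.
rewrite -[LHS]mulr1 -(det_finmx_unitri S1 Srank) -det_mulmx finmx_mul.
exact: det_finmx_rows.
Qed.

End FinMatrix.

(** * Forward orbits of a self-map *)

Lemma fconnect_step (T : finType) (f : T -> T) p q :
  fconnect f p q = (p == q) || fconnect f (f p) q.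
Proof.
apply/idP/orP => [/iter_findex|[/eqP->|]]; last 2 first.
- exact: connect0.
- by apply: connect_trans; exact: fconnect1.
case: (findex f p q) => [/= <-|k]; first by left.
by rewrite iterSr => <-; right; exact: fconnect_iter.
Qed.

(** The points of a cycle are revisited forever, whereas an orbit that meets a fixed point stays
    there. *)
Lemma fconnect_anti (T : finType) (f : T -> T) p q z : f z = z ->
  fconnect f p z -> fconnect f p q -> fconnect f q p -> p = q.
Proof.
move=> fz /iter_findex pz /iter_findex pq /iter_findex qp.
set c := findex f p z in pz; set a := findex f p q in pq.
set b := findex f q p in qp.
have cycle k : iter (k * (b + a)) f p = p.
  elim: k => // k IHk; rewrite mulSn iterD IHk iterD pq; exact: qp.
have [a0|a_gt0] := posnP a; first by rewrite -pq a0.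
have pE : p = z.
  (* As [a > 0], [c] turns of the cycle take at least the [c] steps after which the orbit of [p]
     stays at [z]. *)
  have /subnKC ckE : (c <= c * (b + a))%N.
    by rewrite leq_pmulr // addn_gt0 a_gt0 orbT.
  by rewrite -(cycle c) -ckE addnC iterD pz iter_fix.
by rewrite -pq pE iter_fix.
Qed.

(** * The classes of ~ as basins of a self-map *)

Section Network.
Variables (n T : nat) (gamma : mutation_sequence n T).
Local Notation V := ('I_n * 'I_T.+1)%type.

Definition square_node (t : 'I_T) : V := (mut gamma t, before t).

(* Follows [glue] forward; the pairs from which it cannot continue are the
   [square_node t] and are made fixed points. *)
Definition glue_step (p : V) : V :=
  if insub (val p.2) is Some t then
    if p.1 == mut gamma t then p else (relabel gamma t p.1, after t)
  else (p.1, ord0).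

Lemma square_node_inj : injective square_node.
Proof. by move=> s t [_ /val_inj]. Qed.

Lemma insub_before (t : 'I_T) : insub (val (before t)) = Some t.
Proof. by rewrite /= valK. Qed.

Lemma insub_max : insub (val (@ord_max T)) = None :> option 'I_T.
Proof. by rewrite insubF //= ltnn. Qed.

Lemma node_cases (P : V -> Prop) :
  (forall i t, P (i, before t)) -> (forall i, P (i, ord_max)) -> forall p, P p.
Proof.
move=> Pbefore Pmax [i s]; have [s_lt|s_ge] := ltnP s T.
  by rewrite (_ : s = before (Ordinal s_lt)) //; exact/val_inj.
rewrite (_ : s = ord_max) //; apply/val_inj/eqP => /=.
by rewrite eqn_leq s_ge -ltnS ltn_ord.
Qed.

Lemma glue_step_before i t : glue_step (i, before t) =
  if i == mut gamma t then (i, before t) else (relabel gamma t i, after t).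
Proof. by rewrite /glue_step insub_before. Qed.

Lemma glue_step_max i : glue_step (i, ord_max) = (i, ord0).
Proof. by rewrite /glue_step insub_max. Qed.

Lemma glue_step_square t : glue_step (square_node t) = square_node t.
Proof. by rewrite glue_step_before eqxx. Qed.

Lemma codom_square_before i t :
  ((i, before t) \in codom square_node) = (i == mut gamma t).
Proof.
apply/codomP/eqP => [[s [-> /val_inj ->]] //|->].
by exists t.
Qed.

Lemma codom_square_max i : ((i, ord_max) \in codom square_node) = false.
Proof.
apply/codomP => -[s [_ Ts]].
by have := ltn_ord s; rewrite -Ts ltnn.
Qed.

(** Away from the square nodes the relation is the graph of [glue_step], so that classes can be
    studied through forward orbits. *)
Lemma glueE p q :
  Defs.glue gamma p q = (p \notin codom square_node) && (q == glue_step p).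
Proof.
apply/idP/idP => [/orP[/existsP[t /existsP[i]]|/existsP[i]]|].
- move=> /and3P[/negbTE it /eqP-> /eqP->].
  by rewrite codom_square_before glue_step_before it eqxx.
- move=> /andP[/eqP-> /eqP->].
  by rewrite codom_square_max glue_step_max eqxx.
elim/node_cases: p => [i t|i].
  rewrite codom_square_before glue_step_before.
  move=> /andP[it]; rewrite (negbTE it) => /eqP->; apply/orP; left.
  by apply/existsP; exists t; apply/existsP; exists i; rewrite it !eqxx.
rewrite glue_step_max => /andP[_ /eqP->]; apply/orP; right.
by apply/existsP; exists i; rewrite !eqxx.
Qed.

Lemma glue_equiv_sym :
  connect_sym (fun p q => Defs.glue gamma p q || Defs.glue gamma q p).
Proof. by apply: sym_connect_sym => p q; rewrite orbC. Qed.

Lemma edge_class_eq p q :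
  (edge_class gamma p == edge_class gamma q) = glue_equiv gamma p q.
Proof.
apply/eqP/idP => [pq|pq].
  have : q \in edge_class gamma q by rewrite inE; exact: connect0.
  by rewrite -pq inE.
apply/setP => r; rewrite !inE.
exact: (same_connect glue_equiv_sym).
Qed.

(** Whether an orbit reaches the fixed point [square_node t] is the same for two glued pairs, hence
    constant on classes; conversely, an orbit is a chain of glued pairs. *)
Lemma edge_class_square p t :
  (edge_class gamma p == edge_class gamma (square_node t)) =
  fconnect glue_step p (square_node t).
Proof.
have reach_closed : fingraph.closed
    (fun q r => Defs.glue gamma q r || Defs.glue gamma r q)
    [pred q | fconnect glue_step q (square_node t)].
  have glued q r : Defs.glue gamma q r ->
      fconnect glue_step q (square_node t) = fconnect glue_step r (square_node t).
    rewrite glueE => /andP[q_notin /eqP->]; rewrite fconnect_step.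
    by case: eqP => // qE; rewrite qE codom_f in q_notin.
  by move=> q r /orP[] /glued; rewrite !inE.
rewrite edge_class_eq; apply/idP/idP => [/(closed_connect reach_closed)|].
  by rewrite !inE connect0.
move=> /iter_findex <-.
elim: (findex _ _ _) => [|k IHk]; first exact: connect0.
apply: connect_trans IHk _; rewrite /=; set q := iter _ _ _.
have [/codomP[s ->]|q_notin] := boolP (q \in codom square_node).
  by rewrite glue_step_square connect0.
by apply: connect1; rewrite glueE q_notin eqxx.
Qed.

Lemma edge_class_before i t : i != mut gamma t ->
  edge_class gamma (relabel gamma t i, after t) = edge_class gamma (i, before t).
Proof.
move=> it; apply/esym/eqP; rewrite edge_class_eq; apply: connect1.
by rewrite glueE codom_square_before it glue_step_before (negbTE it) eqxx.
Qed.

(** * Two evaluations of the determinant of the cyclic linear system *)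

Section Determinant.
Variable b : 'I_T -> 'I_n -> int.
Hypothesis b_mut : forall t, b t (mut gamma t) = 0.

(** For [trop_coef] as [b], right multiplication by this matrix is one step of the C-matrix,
    relabelling included. Since [b t (mut gamma t) = 0], the subtracted term makes the entry at the
    image of [mut gamma t] equal to [-1]. *)
Definition step_mx (t : 'I_T) : 'M[int]_n := \matrix_(i, j)
  if i == mut gamma t
  then b t ((relabel gamma t)^-1%g j) - (j == relabel gamma t i)%:R
  else (j == relabel gamma t i)%:R.

Definition step_prod (s t : nat) : 'M[int]_n :=
  \prod_(s <= u < t) if insub u is Some v then step_mx v else 1.

(* The matrix of the linear system v(t) = step_mx t * v(t+1), v(T) = v(0). *)
Definition system (p q : V) : int := (p == q)%:R -
  (if insub (val p.2) is Some t
   then \sum_j step_mx t p.1 j * ((j, after t) == q)%:R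
   else ((p.1, ord0) == q)%:R).

Lemma sum_delta (p : V) (S : V -> int) : \sum_q (p == q)%:R * S q = S p.
Proof.
rewrite (bigD1 p) //= eqxx mul1r big1 ?addr0 // => q qp.
by rewrite eq_sym (negbTE qp) mul0r.
Qed.

Lemma system_before i t (S : V -> int) :
  \sum_q system (i, before t) q * S q =
  S (i, before t) - \sum_j step_mx t i j * S (j, after t).
Proof.
rewrite /system /= valK.
under eq_bigr do rewrite mulrBl; rewrite sumrB sum_delta; congr (_ - _).
under [LHS]eq_bigr => q _ do rewrite mulr_suml.
rewrite exchange_big /=.
by apply: eq_bigr => j _; under eq_bigr do rewrite -mulrA; rewrite -mulr_sumr sum_delta.
Qed.

Lemma system_max i (S : V -> int) :
  \sum_q system (i, ord_max) q * S q = S (i, ord_max) - S (i, ord0).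
Proof.
rewrite /system insub_max.
by under eq_bigr do rewrite mulrBl; rewrite sumrB !sum_delta.
Qed.

Lemma step_prodS (t : 'I_T) s : (t < s)%N ->
  step_prod t s = step_mx t *m step_prod t.+1 s.
Proof. by move=> ts; rewrite /step_prod big_ltn // valK. Qed.

Lemma step_prod_refl t : step_prod t t = 1%:M.
Proof. by rewrite /step_prod big_geq. Qed.

Lemma step_prod0S (t : 'I_T) : step_prod 0 t.+1 = step_prod 0 t *m step_mx t.
Proof. by rewrite /step_prod big_nat_recr //= valK. Qed.

Lemma det_system_monodromy :
  \det (finmx system) = \det (1%:M - step_prod 0 T).
Proof.
(* The columns of [S] are the fundamental solutions of the recursion, read backwards from the time
   of [q]; the rank is the number of steps left until [T]. *)
pose S (p q : V) : int :=
  if (p.2 <= q.2)%N then step_prod p.2 q.2 p.1 q.1 else 0.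
pose g (j : 'I_n) : V := (j, ord_max).
have g_inj : injective g by move=> i j [].
rewrite (@det_finmx_eliminate _ _ _ S (fun p => T - p.2)%N _ g) //.
- congr (\det _); apply/matrixP => i j; rewrite !mxE system_max /S /=.
  by rewrite leqnn step_prod_refl mxE.
- by case=> i s; rewrite /S leqnn step_prod_refl mxE eqxx.
- move=> [i s] [j t] pq; rewrite /S /=; case: (ltngtP s t) => [st _|_|].
  + by apply: ltn_sub2l => //; apply: leq_trans st _; rewrite -ltnS.
  + by rewrite eqxx.
  + move=> st; rewrite st step_prod_refl mxE.
    case: (i =P j) => [ij|]; last by rewrite eqxx.
    by rewrite ij (val_inj st) eqxx in pq.
elim/node_cases=> [i t|i] [j s]; last by rewrite codom_f.
move=> _; rewrite system_before /S /=.
rewrite xpair_eqE andbC (_ : (before t == s) = (t == s :> nat)) //.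
(* Before time [s] the recursion cancels the two terms, after [s] both vanish, and at [s] only the
   identity is left. *)
case: (ltngtP t s) => [ts|st|ts].
- rewrite step_prodS // mxE; apply/eqP; rewrite /= mulr0n subr_eq0; apply/eqP.
  by [].
- by rewrite big1 ?subr0 // => k _; exact: mulr0.
- by rewrite ts step_prod_refl mxE big1 ?subr0 // => k _; exact: mulr0.
Qed.

(** Away from the square nodes the equations read [v(p) = v(glue_step p)], so [S] records
    reachability and the rank is the size of the forward orbit. The surviving rows are indexed by
    the steps [t], whence the transposition. *)
Lemma det_system_network : fully_mutated gamma ->
  \det (finmx system) = \det (\matrix_(s, t)
    (broken_edges gamma (edge_class gamma (square_node s)) t -
     \sum_(i | edge_class gamma (i, before t) ==
                edge_class gamma (square_node s)) b t i)).
Proof.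
move=> gamma_full.
(* Full mutation puts a square node into every class, so every orbit ends in one and there are no
   proper cycles. *)
have reach p : exists t, fconnect glue_step p (square_node t).
  have [|t] := gamma_full (edge_class gamma p); first exact: imset_f.
  by rewrite inE -edge_class_eq edge_class_square; exists t.
have anti p q : fconnect glue_step p q -> fconnect glue_step q p -> p = q.
  by have [t] := reach p; apply: fconnect_anti; exact: glue_step_square.
pose S (p q : V) : int := (fconnect glue_step p q)%:R.
pose rank (p : V) := #|fconnect glue_step p|.
rewrite -[RHS]det_tr (@det_finmx_eliminate _ _ _ S rank _ square_node).
(* The diagonal term and the [-1] in the row of [mut gamma t] give the two broken edges; the values
   of [b] give the sum over the class. *)
- congr (\det _); apply/matrixP => t s; rewrite !mxE system_before /S.
  rewrite /broken_edges -!edge_class_square -addrA; congr (_ + _).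
  under eq_bigr => j _ do rewrite mxE eqxx mulrBl.
  rewrite sumrB opprB; congr (_ - _).
    rewrite (bigD1 (relabel gamma t (mut gamma t))) //= eqxx mul1r.
    rewrite big1 ?addr0 ?edge_class_square // => j /negbTE->; exact: mul0r.
  (* Undoing the relabelling moves the sum to [before t]; only the index [mut gamma t] is not glued
     across the step, and there [b] vanishes. *)
  rewrite (reindex_inj (@perm_inj _ (relabel gamma t))) /= [RHS]big_mkcond /=.
  apply: eq_bigr => i _; rewrite permK -edge_class_square.
  have [->|it] := eqVneq i (mut gamma t); first by rewrite b_mut mul0r if_same.
  by rewrite edge_class_before //; case: ifP; rewrite (mulr1, mulr0).
- exact: square_node_inj.
- by move=> p; rewrite /S connect0.
- move=> p q pq; rewrite /S pnatr_eq0 eqb0 negbK => conn_pq.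
  apply: proper_card; apply/fintype.properP; split.
    by apply/fintype.subsetP => r; rewrite !inE; exact: connect_trans.
  exists p; rewrite !inE ?connect0 //; apply: contra_neqN pq => conn_qp.
  exact: anti.
move=> p q p_notin.
have -> : \sum_r system p r * S r q = S p q - S (glue_step p) q.
  elim/node_cases: p p_notin => [i t|i] p_notin; last first.
    by rewrite system_max glue_step_max.
  rewrite codom_square_before in p_notin.
  rewrite system_before glue_step_before (negbTE p_notin); congr (_ - _).
  rewrite (bigD1 (relabel gamma t i)) //= !mxE (negbTE p_notin) eqxx mul1r.
  rewrite big1 ?addr0 // => j /negbTE jt.
  by rewrite mxE (negbTE p_notin) jt mul0r.
rewrite /S fconnect_step; case: eqP => [<-|_] /=; last by rewrite subrr.
(* A return to [p] would make [p] a fixed point; as its orbit ends in a square node, [p] would then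
   be one. *)
suff -> : fconnect glue_step (glue_step p) p = false by rewrite subr0.
apply: contraNF p_notin => cyc.
have fixp : glue_step p = p by apply: anti => //; exact: fconnect1.
have [t /iter_findex pt] := reach p.
by rewrite -[p](iter_fix (findex glue_step p (square_node t)) fixp) pt codom_f.
Qed.

End Determinant.
End Network.

(** * Leading terms of rational functions at the origin *)

Lemma log_deriv_quotient (K : fieldType) (u v du dv y : K) : u != 0 -> v != 0 ->
  (u / v)^-1 * ((du * v - u * dv) / v ^+ 2) * y = y * du / u - y * dv / v.
Proof. by move=> u0 v0; field; rewrite u0 v0. Qed.

Section Residue.
Variable n : nat.
Implicit Types (x y : ratfun n) (p q : multinom n) (f g : mpoly n rat).

Local Notation const_coeff := (mcoeff (@mnm0 n)).

(** The image of [x] in the residue field of the local ring at the origin; through it all limits are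
    computed algebraically. *)
Definition residue x (a : rat) : Prop := exists f g : mpoly n rat,
  [/\ const_coeff f = a, const_coeff g = 1 & x = tofun f / tofun g].

Lemma const_coeff1_neq0 f : const_coeff f = 1 -> f != 0.
Proof. by apply: contra_eq_neq => ->; rewrite mcoeff0 eq_sym oner_eq0. Qed.

Lemma residueD x y a b : residue x a -> residue y b -> residue (x + y) (a + b).
Proof.
move=> [f [g [fa g1 ->]]] [f' [g' [fb g'1 ->]]].
exists (f * g' + f' * g), (g * g').
rewrite rmorphD !rmorphM /= fa g1 fb g'1 !mulr1; split=> //.
by rewrite addf_div ?tofun_eq0 ?const_coeff1_neq0 // tofunD !tofunM.
Qed.

Lemma residueM x y a b : residue x a -> residue y b -> residue (x * y) (a * b).
Proof.
move=> [f [g [fa g1 ->]]] [f' [g' [fb g'1 ->]]].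
exists (f * f'), (g * g').
rewrite !rmorphM /= fa g1 fb g'1 mulr1; split=> //.
by rewrite mulf_div !tofunM.
Qed.

Lemma residueV x : residue x 1 -> residue x^-1 1.
Proof. by move=> [f [g [f1 g1 ->]]]; exists g, f; rewrite invf_div. Qed.

Lemma residue_int (k : int) : residue k%:~R k%:~R.
Proof.
exists k%:~R, 1; rewrite tofun1 divr1 rmorph_int rmorph1; split=> //.
by rewrite /tofun rmorph_int.
Qed.

Lemma residueB x y a b : residue x a -> residue y b -> residue (x - y) (a - b).
Proof.
move=> xa yb; rewrite -(mulN1r y) -(mulN1r b).
by apply: residueD => //; apply: residueM => //; exact: (residue_int (-1)).
Qed.

(** On the diagonal a polynomial is univariate, which reduces continuity to that of [horner]. *)
Lemma mmap_diagonal (R : realType) f (e : R) :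
  mmap (@ratr R) (fun=> e) f =
  (\sum_(m <- msupp f) (ratr (mcoeff m f))%:P * 'X^(mdeg m)).[e].
Proof.
rewrite /mmap horner_sum; apply: eq_bigr => m _.
rewrite hornerM hornerC hornerXn /mmap1 mdegE; congr (_ * _).
exact: prodrXr.
Qed.

Lemma cvg_mmap_diagonal (R : realType) f :
  ((fun e : R => mmap (@ratr R) (fun=> e) f) @ 0^'+ -->
   (ratr (const_coeff f) : R))%classic.
Proof.
(* The limit is the value at 0, where [0 ^ 0 = 1] leaves the constant term alone. *)
rewrite (_ : ratr _ = mmap (@ratr R) (fun=> 0) f); last first.
  rewrite {1}[f]mpolyE raddf_sum rmorph_sum /mmap; apply: eq_bigr => m _ /=.
  rewrite mcoeffZ mcoeffX rmorphM rmorph_nat /mmap1; congr (_ * _).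
  by rewrite prodrXr -mdegE expr0n mdeg_eq0.
apply: cvg_at_right_filter; under eq_fun do rewrite mmap_diagonal.
rewrite mmap_diagonal; exact: continuous_horner.
Qed.

Lemma cvg_ratfun_eval (R : realType) x a : residue x a ->
  ((fun e : R => ratfun_eval x (fun=> e)) @ 0^'+ --> (ratr a : R))%classic.
Proof.
move=> [f [g [<- g1 ->]]].
have cvg_g := @cvg_mmap_diagonal R g; rewrite g1 rmorph1 in cvg_g.
rewrite -[ratr _]divr1.
have cvg_fg : ((fun e : R => mmap (@ratr R) (fun=> e) f / mmap (@ratr R) (fun=> e) g)
    @ 0^'+ --> (ratr (const_coeff f) : R) / 1)%classic.
  apply: cvgM; first exact: cvg_mmap_diagonal.
  by apply: cvgV => //; exact: oner_neq0.
(* [ratfun_evalE] gives the quotient only where [g] does not vanish, which holds near 0 since [g]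
   tends to 1. *)
apply: cvg_trans cvg_fg; apply: near_eq_cvg.
have : (\forall e \near 0^'+, mmap (@ratr R) (fun=> e) g != 0)%classic.
  by apply: (cvgr_neq0 _ cvg_g); exact: oner_neq0.
by apply: filterS => e e_neq0; rewrite ratfun_evalE.
Qed.

(* [c] is the exponent vector of the leading Laurent monomial of [x] at the
   origin, written as the difference [p - q] of two multinomials. *)
Definition expands x (c : 'cV[int]_n) : Prop :=
  exists p q f g, [/\ const_coeff f = 1, const_coeff g = 1,
    x = tofun (mpolyX rat p * f) / tofun (mpolyX rat q * g) &
    forall i, c i 0 = (p i)%:Z - (q i)%:Z].

Lemma monomial_neq0 p : mpolyX rat p != 0.
Proof. by rewrite -msupp_eq0 msuppX. Qed.

Lemma expands_neq0 x c : expands x c -> x != 0.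
Proof.
move=> [p [q [f [g [/const_coeff1_neq0 f0 /const_coeff1_neq0 g0 -> _]]]]].
by rewrite mulf_neq0 ?invr_eq0 // tofun_eq0 mulf_neq0 // monomial_neq0.
Qed.

Lemma expandsM x y c d : expands x c -> expands y d -> expands (x * y) (c + d).
Proof.
move=> [p [q [f [g [f1 g1 -> cE]]]]] [p' [q' [f' [g' [f'1 g'1 -> dE]]]]].
exists (mnm_add p p'), (mnm_add q q'), (f * f'), (g * g').
split; rewrite ?rmorphM /= ?f1 ?g1 ?f'1 ?g'1 //.
  by rewrite mulf_div -!tofunM !mpolyXD mulrACA [X in _ / tofun X]mulrACA.
by move=> i; rewrite mxE cE dE !mnmDE !PoszD opprD addrACA.
Qed.

Lemma expandsV x c : expands x c -> expands x^-1 (- c).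
Proof.
move=> [p [q [f [g [f1 g1 -> cE]]]]]; exists q, p, g, f.
by split; rewrite ?invf_div // => i; rewrite mxE cE opprB.
Qed.

Lemma expands_residue1 x : residue x 1 -> expands x 0.
Proof.
move=> [f [g [f1 g1 ->]]]; exists mnm0, mnm0, f, g.
by split; rewrite ?mpolyX0 ?mul1r // => i; rewrite mxE subrr.
Qed.

Lemma expandsX x c (a : int) : expands x c -> expands (x ^ a) (c *~ a).
Proof.
move=> xc; have pow k : expands (x ^+ k) (c *+ k).
  elim: k => [|k IHk]; first exact/expands_residue1/(residue_int 1).
  by rewrite exprS mulrS; exact: expandsM.
case: a => k; first exact: pow.
by apply: expandsV; exact: pow.
Qed.

Lemma expands_indet (i : 'I_n) : expands (indet i) (delta_mx i 0).
Proof.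
exists (mnm1 i), mnm0, 1, 1; rewrite !rmorph1; split=> //.
  by rewrite mpolyX0 !mulr1 tofun1 divr1.
by move=> j; rewrite mxE mnm1E mnm0E subr0 andbT eq_sym; case: eqP.
Qed.

(** A non-negative [c] makes [y^q] divide [y^p]; as [c] is non-zero, the quotient monomial has no
    constant term. *)
Lemma expands_pos_residue x c : expands x c -> (forall i, 0 <= c i 0) -> c != 0 ->
  residue x 0.
Proof.
move=> [p [q [f [g [f1 g1 xE cE]]]]] c_ge0 c_neq0.
have qp : mpoly.lem q p.
  by apply/mnm_lepP => i; have := c_ge0 i; rewrite cE subr_ge0 lez_nat.
exists (mpolyX rat (mnm_sub p q) * f), g; split=> //.
  rewrite rmorphM /= f1 mulr1 mcoeffX; case: eqP => // pq0.
  case/eqP: c_neq0; apply/colP => i.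
  by rewrite cE -(submK qp) pq0 add0m subrr mxE.
rewrite xE -{1}(submK qp) mpolyXD mulrAC [_ * f * _]mulrC !tofunM.
rewrite -mulf_div divff ?mul1r // tofun_eq0 monomial_neq0 //.
Qed.

Lemma expands_neg_residue x c : expands x c -> (forall i, c i 0 <= 0) -> c != 0 ->
  residue x^-1 0.
Proof.
move=> /expandsV xc c_le0 c_neq0; apply: expands_pos_residue xc _ _.
  by move=> i; rewrite mxE oppr_ge0.
by rewrite oppr_eq0.
Qed.

Lemma has_signN c b : has_sign b c -> has_sign (~~ b) (- c : 'cV[int]_n).
Proof.
move=> [c0 c_sign]; split; first by rewrite oppr_eq0.
by move=> i; have := c_sign i; rewrite mxE; case: b {c_sign};
  rewrite /= (oppr_le0, oppr_ge0).
Qed.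

(** Here sign-coherence makes addition compatible with its tropical version. For a positive sign
    [x + 1] has value 1 at the origin; for a negative one this holds for the second factor of
    [x (x^-1 + 1)]. *)
Lemma expandsD1 b x c : expands x c -> has_sign b c ->
  expands (x + 1) (\col_i Num.min (c i 0) 0).
Proof.
move=> xc [c_neq0 c_sign]; case: b c_sign => c_sign.
  rewrite (_ : \col_i _ = 0); last first.
    by apply/colP => i; rewrite !mxE; exact: min_r.
  apply: expands_residue1; rewrite -[X in residue _ X]add0r.
  apply: residueD (residue_int 1); exact: expands_pos_residue xc _ _.
rewrite (_ : \col_i _ = c + 0); last first.
  by apply/colP => i; rewrite !mxE addr0; exact: min_l.
rewrite (_ : x + 1 = x * (x^-1 + 1)); last first.
  by rewrite mulrDr mulr1 mulfV ?(expands_neq0 xc) // addrC.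
apply: expandsM => //; apply: expands_residue1; rewrite -[X in residue _ X]add0r.
apply: residueD (residue_int 1); exact: expands_neg_residue xc _ _.
Qed.

(** The logarithmic derivative of [y^p f], times [y_j], is [p_j] plus [y_j] times that of [f], and
    the latter term vanishes at the origin. *)
Lemma residue_log_deriv_poly (j : 'I_n) p f : const_coeff f = 1 ->
  residue (tofun (mpolyX rat (mnm1 j) * mderiv j (mpolyX rat p * f))
           / tofun (mpolyX rat p * f)) (p j)%:R.
Proof.
move=> f1; exists ((p j)%:R *: f + mpolyX rat (mnm1 j) * mderiv j f), f; split=> //.
  rewrite rmorphD rmorphM /= mcoeffZ f1 mulr1 mcoeffX mnm1_eq0 mul0r.
  by rewrite addr0.
rewrite mderivM mderivX mulrDr.
have -> : mpolyX rat (mnm1 j) *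
    ((p j)%:R *: mpolyX rat (mnm_sub p (mnm1 j)) * f) =
    mpolyX rat p * ((p j)%:R *: f).
  (* Subtraction of multinomials is truncated, so [p j = 0] is treated apart: the term then has
     coefficient 0. *)
  have [->|pj] := eqVneq (p j) 0%N; first by rewrite !scale0r !(mul0r, mulr0).
  rewrite -[X in _ = mpolyX rat X * _](submK (_ : mpoly.lem (mnm1 j) p)) ?lep1mP //.
  rewrite mpolyXD.
  rewrite -scalerAl -!scalerAr; congr (_ *: _).
  by rewrite mulrA [X in X * f]mulrC.
rewrite mulrCA -mulrDr !tofunM -mulf_div divff ?mul1r //.
by rewrite tofun_eq0 monomial_neq0.
Qed.

Lemma residue_log_deriv (j : 'I_n) x c : expands x c ->
  residue (x^-1 * ratfun_deriv j x * indet j) (c j 0)%:~R.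
Proof.
move=> [p [q [f [g [f1 g1 -> ->]]]]].
have F0 : mpolyX rat p * f != 0 by rewrite mulf_neq0 ?monomial_neq0 ?const_coeff1_neq0.
have G0 : mpolyX rat q * g != 0 by rewrite mulf_neq0 ?monomial_neq0 ?const_coeff1_neq0.
have := residueB (residue_log_deriv_poly j p f1) (residue_log_deriv_poly j q g1).
rewrite ratfun_derivE // -[(_ - _)%:~R]/(_%:~R) rmorphB /=.
move: (mpolyX rat p * f) (mpolyX rat q * g) F0 G0 => F G F0 G0.
rewrite /indet !tofunM tofunB !tofunM log_deriv_quotient ?tofun_eq0 //.
Qed.

End Residue.

(** * Tropical seeds, C-matrices and the values at the origin *)

(** The mutation of [B] does not involve [Y], so every semifield produces the same exchange
    matrices. *)
Lemma yseed_B_at (S : semifield) n T (y : 'I_n -> S)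
    (gamma : mutation_sequence n T) t :
  yseed_B (seed_at y gamma t) = B_at gamma t.
Proof.
rewrite /B_at /seed_at; move: (take _ _) => l.
set s := YSeed _ y; set s' := YSeed _ _.
have : yseed_B s = yseed_B s' by [].
elim: l s s' => //= a l IHl s s' ss'; apply: IHl => /=.
by rewrite ss'.
Qed.

Lemma step_ind T (P : nat -> Prop) :
  P 0%N -> (forall t : 'I_T, P t -> P t.+1) -> forall t, (t <= T)%N -> P t.
Proof.
move=> P0 PS; elim=> // t IHt tT; apply: (PS (Ordinal tT)); exact/IHt/ltnW.
Qed.

Section TropicalSeeds.
Variables (n T : nat) (gamma : mutation_sequence n T).

Lemma B_at_diag t i : B_at gamma t i i = 0.
Proof.
have [d [d_gt0 /(_ i i)/eqP]] := yseed_skew (seed_at (@Fsf_indet n) gamma t).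
rewrite -/(B_at gamma t) -subr_eq0 opprK -mulr2n -mulrnAl mulf_eq0.
by rewrite mulrn_eq0 /= gt_eqF //= => /eqP.
Qed.

Lemma Fsf_powE (x : Fsf n) a : sval (sf_pow x a) = sval x ^ a.
Proof.
have pow k : sval (iter k (sf_mul x) (sf_one (Fsf n))) = sval x ^+ k.
  by elim: k => //= k ->; rewrite exprS.
by case: a => k; rewrite /= ?pow // -exprS.
Qed.

Lemma Ftrop_powE (x : Ftrop n) a : sf_pow x a = x *~ a.
Proof.
have pow k : iter k (sf_mul x) (sf_one (Ftrop n)) = x *+ k.
  by elim: k => //= k ->; rewrite mulrS.
by case: a => k; rewrite /= ?pow // -mulrS.
Qed.

Lemma Y_atS (t : 'I_T) i : Y_at gamma t.+1 (relabel gamma t i) =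
  sval (Y_mutation (mut gamma t) (B_at gamma t)
    (yseed_Y (seed_at (@Fsf_indet n) gamma t)) i).
Proof. by rewrite /Y_at seed_atS /= permK. Qed.

Lemma Ytrop_atS (t : 'I_T) i : Ytrop_at gamma t.+1 (relabel gamma t i) =
  Y_mutation (mut gamma t) (B_at gamma t)
    (yseed_Y (seed_at (@Ftrop_indet n) gamma t)) i.
Proof. by rewrite /Ytrop_at seed_atS /= permK yseed_B_at. Qed.

Variable eps : T.-tuple bool.
Hypothesis epsP : is_tropical_sign gamma eps.

Lemma Ytrop_sign (t : 'I_T) :
  has_sign (tnth eps t) (Ytrop_at gamma t (mut gamma t)).
Proof.
have := epsP t; congr (has_sign _ _).
by apply/colP => i; rewrite !mxE.
Qed.

(** The only sums in a mutation are [Y + 1] and [Y^-1 + 1] at the mutated index. Their exponent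
    vectors [c] and [- c] are signed, so [expandsD1] applies. *)
Lemma Y_at_expands t : (t <= T)%N ->
  forall i, expands (Y_at gamma t i) (Ytrop_at gamma t i).
Proof.
move: t; apply: step_ind => [|t IHt] i.
  by rewrite /Y_at /Ytrop_at !seed_at0; exact: expands_indet.
rewrite -(permKV (relabel gamma t) i); move: (_ i) => {}i.
rewrite Y_atS Ytrop_atS /Y_mutation.
have sgn := Ytrop_sign t; have exk := IHt (mut gamma t).
case: ifP => _; first exact: expandsV.
case: ifP => _ /=.
  apply: expandsM; first exact: IHt.
  rewrite Fsf_powE Ftrop_powE; apply: expandsX.
  have := expandsD1 (expandsV exk) (has_signN sgn).
  by congr (expands _ _); apply/colP => r; rewrite !mxE.
apply: expandsM; first exact: IHt.
rewrite Fsf_powE Ftrop_powE; apply: expandsX.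
have := expandsD1 exk sgn.
by congr (expands _ _); apply/colP => r; rewrite !mxE.
Qed.

(** In the usual notation [[eps_t B_(m_t,i)]_+], the arrow multiplicity that enters column [t] of
    [A_sign]. *)
Definition trop_coef (t : 'I_T) (i : 'I_n) : int :=
  if tnth eps t then Num.max 0 (B_at gamma t (mut gamma t) i)
  else Num.max 0 (- B_at gamma t (mut gamma t) i).

Lemma trop_coef_mut t : trop_coef t (mut gamma t) = 0.
Proof. by rewrite /trop_coef B_at_diag oppr0 maxxx if_same. Qed.

Lemma Ytrop_at_linear (t : 'I_T) i : Ytrop_at gamma t.+1 (relabel gamma t i) =
  if i == mut gamma t then - Ytrop_at gamma t i
  else Ytrop_at gamma t i + Ytrop_at gamma t (mut gamma t) *~ trop_coef t i.
Proof.
rewrite Ytrop_atS /Y_mutation; case: ifP => [/eqP-> //|_].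
have [_ sgn] := Ytrop_sign t; rewrite /trop_coef.
rewrite -[yseed_Y _]/(Ytrop_at gamma t).
set c := Ytrop_at gamma t (mut gamma t) in sgn *.
set B := B_at gamma t _ i.
have min_pos : (forall r, 0 <= c r 0) ->
    sf_add (sf_inv (c : Ftrop n)) (sf_one (Ftrop n)) = - c /\
    sf_add (c : Ftrop n) (sf_one (Ftrop n)) = 0.
  move=> c_ge0; split; apply/colP => r; rewrite !mxE.
    by apply: min_l; rewrite oppr_le0.
  exact: min_r.
have min_neg : (forall r, c r 0 <= 0) ->
    sf_add (sf_inv (c : Ftrop n)) (sf_one (Ftrop n)) = 0 /\
    sf_add (c : Ftrop n) (sf_one (Ftrop n)) = c.
  move=> c_le0; split; apply/colP => r; rewrite !mxE.
    by apply: min_r; rewrite oppr_ge0.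
  exact: min_l.
(* The sum raised to the power [- B] is trivial when [B] and [c] have opposite signs; when they
   agree, [c] is added [|B|] times. *)
case: ifP => B0; case: (tnth eps t) sgn => [/min_pos|/min_neg] [E1 E2];
  rewrite Ftrop_powE; congr (_ + _).
- by rewrite E1 mulNrz mulrNz opprK max_r.
- by rewrite E1 mul0rz max_l ?oppr_le0.
- by rewrite E2 mul0rz max_l // leNgt; apply: contraFN B0; exact: ltW.
- by rewrite E2 max_r // oppr_ge0 ltW // ltNge B0.
Qed.

Lemma C_mxS (t : 'I_T) :
  C_mx gamma t.+1 = C_mx gamma t *m step_mx gamma trop_coef t.
Proof.
apply/matrixP => r j; rewrite -(permKV (relabel gamma t) j); move: (_ j) => {}j.
rewrite !mxE Ytrop_at_linear (bigD1 (mut gamma t)) //= !mxE eqxx permK.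
rewrite (inj_eq perm_inj); case: eqP => [->|/eqP jm].
  rewrite trop_coef_mut big1 => [|i im].
    by rewrite addr0 sub0r mulrN1 mxE.
  by rewrite !mxE (negbTE im) (inj_eq perm_inj) eq_sym (negbTE im) mulr0.
rewrite (bigD1 j) //= big1 => [|i /andP[im ij]].
  rewrite !mxE (negbTE jm) eqxx addr0 mulr1 subr0 addrC; congr (_ + _).
  by rewrite -scaler_int !mxE intz mulrC.
by rewrite !mxE (negbTE im) (inj_eq perm_inj) eq_sym (negbTE ij) mulr0.
Qed.

Lemma C_mxE t : (t <= T)%N -> C_mx gamma t = step_prod gamma trop_coef 0 t.
Proof.
move: t; apply: step_ind => [|t IHt]; last by rewrite C_mxS IHt step_prod0S.
rewrite step_prod_refl; apply/matrixP => i j; rewrite !mxE.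
by rewrite /Ytrop_at seed_at0 /= mxE eqxx andbT.
Qed.

(** Both sides are the determinant of [system] for [trop_coef], whose sums over a class are the
    arrow counts of sign [eps_t]. *)
Lemma det_C_mx : fully_mutated gamma ->
  \det (1%:M - C_mx gamma T) = \det (A_sign gamma eps).
Proof.
move=> gamma_full; rewrite C_mxE // -det_system_monodromy.
rewrite (det_system_network trop_coef_mut gamma_full); congr (\det _).
apply/matrixP => s t; rewrite !mxE /arrows_from_square /arrows_to_square /trop_coef.
by case: (tnth eps t).
Qed.

Lemma residue_z_plus t : residue (z_plus gamma t) (~~ tnth eps t)%:R.
Proof.
have exk := Y_at_expands (ltnW (ltn_ord t)) (mut gamma t).
have y0 := expands_neq0 exk; move: y0 exk; rewrite /z_plus.
move: (Y_at _ _ _) => y y0 exk; have [c0] := Ytrop_sign t.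
case: (tnth eps t) => sgn /=.
  have y_res := expands_pos_residue exk sgn c0.
  rewrite -[X in residue _ X](mul0r 1); apply: residueM => //.
  apply: residueV; rewrite -[X in residue _ X]add0r.
  exact: residueD y_res (residue_int n 1).
have y_res := expands_neg_residue exk sgn c0.
(* For a negative sign it is [y^-1], not [y], that is regular at the origin. *)
rewrite (_ : y / (y + 1) = (1 + y^-1)^-1); last first.
  by rewrite -[LHS]invf_div mulrDl mul1r mulfV.
apply: residueV; rewrite -[X in residue _ X]addr0.
exact: residueD (residue_int n 1) y_res.
Qed.

Lemma residue_z_minus t : residue (z_minus gamma t) (tnth eps t)%:R.
Proof.
have exk := Y_at_expands (ltnW (ltn_ord t)) (mut gamma t).
have y1_neq0 := expands_neq0 (expandsD1 exk (Ytrop_sign t)).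
rewrite (_ : z_minus gamma t = 1 - z_plus gamma t); last first.
  by rewrite /z_minus /z_plus -[X in X - _](mulfV y1_neq0) -mulrBl addrAC subrr add0r.
rewrite (_ : (tnth eps t)%:R = 1 - (~~ tnth eps t)%:R :> rat); last first.
  by case: (tnth eps t); rewrite ?subr0 ?subrr.
exact: residueB (residue_int n 1) (residue_z_plus t).
Qed.

(** At the origin exactly one of [z_plus] and [z_minus] is 1 and the other 0, so each column is
    selected from [A_minus] or [A_plus]. *)
Lemma residue_AZ_mx s t : residue (AZ_mx gamma s t) (A_sign gamma eps s t)%:~R.
Proof.
have -> : AZ_mx gamma s t = (A_plus gamma s t)%:~R * z_minus gamma t
    + (A_minus gamma s t)%:~R * z_plus gamma t.
  by rewrite /AZ_mx /Z_minus /Z_plus !mul_mx_diag !mxE.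
have -> : (A_sign gamma eps s t)%:~R = (A_plus gamma s t)%:~R * (tnth eps t)%:R
    + (A_minus gamma s t)%:~R * (~~ tnth eps t)%:R :> rat.
  by rewrite [A_sign _ _ _ _]mxE; case: (tnth eps t); rewrite mulr1 mulr0 ?addr0 ?add0r.
apply: residueD; apply: residueM; try exact: residue_int.
  exact: residue_z_minus.
exact: residue_z_plus.
Qed.

(** The entry is [y_i] times the logarithmic derivative in [y_i] of the [j]-th component, so its
    value is an exponent of the leading monomial. *)
Lemma residue_K_mx i j : residue ((K_mx gamma)^T i j) (C_mx gamma T i j)%:~R.
Proof.
have exT k := Y_at_expands (leqnn T) k.
rewrite /K_mx mxE invmx_diag => [|k]; last by rewrite mxE (expands_neq0 (exT k)).
rewrite mul_mx_diag mul_diag_mx !mxE.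
exact: residue_log_deriv (exT j).
Qed.

End TropicalSeeds.

(** * Passage from entries to matrices, and the theorem *)

Lemma cvg_eval_diagonal (R : realType) n p q (M : 'M[ratfun n]_(p, q))
    (A : 'M[int]_(p, q)) :
  (forall i j, residue (M i j) (A i j)%:~R) ->
  ((fun e : R => eval_diagonal M e) @ 0^'+ -->
   map_mx (fun a : int => a%:~R : R) A)%classic.
Proof.
move=> MA P [Q Q_nbhs QP].
(* Matrix neighbourhoods are given entrywise by [Q], and finitely many eventual conditions hold
   simultaneously. *)
have near_Q : (\forall e \near 0^'+,
    forall i j, Q i j (eval_diagonal M (e : R) i j))%classic.
  apply: filter_forall => i; apply: filter_forall => j.
  have := Q_nbhs i j; rewrite !mxE -(ratr_int R) => /(cvg_ratfun_eval (MA i j)).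
  by move=> evQ; near=> e; rewrite mxE; near: e.
by apply: filterS near_Q => e; exact: QP.
Unshelve. all: by end_near. Qed.

Local Open Scope classical_set_scope.
Local Open Scope ring_scope.

Theorem theorem5p3 (R : realType) (n T : nat) (hn : (0 < n)%N) (hT : (0 < T)%N)
    (gamma : mutation_sequence n T) (hgamma : fully_mutated gamma)
    (eps : T.-tuple bool) (heps : is_tropical_sign gamma eps) :
  [/\ (fun e : R => eval_diagonal (K_mx gamma)^T e) @ 0^'+
        --> map_mx (fun a : int => a%:~R : R) (C_mx gamma T),
      (fun e : R => eval_diagonal (AZ_mx gamma) e) @ 0^'+
        --> map_mx (fun a : int => a%:~R : R) (A_sign gamma eps)
    & \det (1%:M - C_mx gamma T) = \det (A_sign gamma eps)].
Proof.
split; last exact: det_C_mx.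
- apply: cvg_eval_diagonal; exact: residue_K_mx heps.
- apply: cvg_eval_diagonal; exact: residue_AZ_mx heps.
Qed.
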